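(* Let $d\geqslant 1$. For every $a$ with $0\leqslant a<\tfrac12$ there exist a real-valued function $f\in L^1(\mathbb{R}^d)$ and an $\epsilon>0$ such that $f(x)\geqslant f\star f(x)$ for almost every $x\in\mathbb{R}^d$, $\int_{\mathbb{R}^d} f(x)\,dx = a$, and $$\int_{\mathbb{R}^d} e^{\epsilon|x|} f(x)\,dx<\infty.$$
   Context: For $f\in L^1(\mathbb{R}^d)$, $f\star f(x) = \int_{\mathbb{R}^d} f(x-y)f(y)\,dy$ denotes the convolution of $f$ with itself. Every real integrable $f$ with $f\geqslant f\star f$ almost everywhere is non-negative almost everywhere, so the integral $\int_{\mathbb{R}^d}e^{\epsilon|x|}f(x)\,dx$ is well defined in $[0,\infty]$. *)

(* Defs.v *)
From HB Require Import structures.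
From mathcomp Require Import all_boot all_order all_algebra.
From mathcomp Require Import all_classical all_reals all_analysis.

Set Implicit Arguments.
Unset Strict Implicit.
Unset Printing Implicit Defensive.

Import Order.TTheory GRing.Theory Num.Theory.
Import numFieldNormedType.Exports.

Local Open Scope classical_set_scope.
Local Open Scope ring_scope.

(* R^n as n-tuples: MathComp-Analysis equips them with the sigma-algebra
   generated by the coordinate maps, i.e. the Borel sigma-algebra of R^n. *)
Notation Rn R n := (n.-tuple (measurableTypeR R)).

Section euclidean_space.
Context {R : realType} {n : nat}.

Definition vsub (x y : Rn R n) : Rn R n :=
  [tuple tnth x i - tnth y i | i < n].

Definition enorm (x : Rn R n) : R := Num.sqrt (\sum_(i < n) tnth x i ^+ 2).

End euclidean_space.

Section lebesgue_succ.
Context {R : realType} {n : nat}.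

Definition consRn (p : measurableTypeR R * Rn R n) : Rn R n.+1 :=
  [tuple of p.1 :: p.2].

Lemma measurable_consRn : measurable_fun setT consRn.
Proof. exact: measurable_cons. Qed.

Variable m : {sigma_finite_measure set (Rn R n) -> \bar R}.

Definition lebesgue_succ : set (Rn R n.+1) -> \bar R :=
  pushforward (lebesgue_measure \x m)%E consRn.

Let lebesgue_succ0 : lebesgue_succ set0 = 0%E.
Proof. by rewrite /lebesgue_succ /pushforward preimage_set0 measure0. Qed.

Let lebesgue_succ_ge0 A : (0 <= lebesgue_succ A)%E.
Proof. exact: (measure_ge0 (lebesgue_measure \x m)%E). Qed.

Let lebesgue_succ_sigma_additive : semi_sigma_additive lebesgue_succ.
Proof.
exact: (@measure_semi_sigma_additive _ _ _
  (measure_function_pushforward__canonical__measure_function_Measure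
    (lebesgue_measure \x m)%E measurable_consRn)).
Qed.

HB.instance Definition _ := isMeasure.Build _ _ _ lebesgue_succ
  lebesgue_succ0 lebesgue_succ_ge0 lebesgue_succ_sigma_additive.

Definition unconsRn (x : Rn R n.+1) : measurableTypeR R * Rn R n :=
  (thead x, [tuple of behead x]).

Lemma measurable_unconsRn : measurable_fun setT unconsRn.
Proof.
apply: measurable_fun_pair; first exact: (measurable_tnth ord0).
exact: measurable_behead.
Qed.

Lemma consRnK : cancel consRn unconsRn.
Proof. by move=> [a b]; rewrite /unconsRn theadE; congr pair; exact: val_inj. Qed.

Lemma lebesgue_succX (A : set (measurableTypeR R)) (B : set (Rn R n)) :
  measurable A -> measurable B ->
  lebesgue_succ (unconsRn @^-1` (A `*` B)) = (lebesgue_measure A * m B)%E.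
Proof.
move=> mA mB; rewrite /lebesgue_succ /pushforward -comp_preimage.
rewrite (_ : unconsRn \o consRn = id) ?product_measure1E//.
by apply/funext => x; exact: consRnK.
Qed.

Lemma lebesgue_succ_sigma_finite : sigma_finite setT lebesgue_succ.
Proof.
have /sigma_finiteP[F [TF ndF Foo]] := sigma_finiteT (@lebesgue_measure R).
have /sigma_finiteP[G [TG ndG Goo]] := sigma_finiteT m.
exists (fun k => unconsRn @^-1` (F k `*` G k)).
  apply/esym/seteqP; split=> // x _ /=.
  have [i _ Fi] : (\bigcup_k F k) (thead x) by rewrite -TF.
  have [j _ Gj] : (\bigcup_k G k) [tuple of behead x] by rewrite -TG.
  exists (maxn i j) => //; split => /=.
    by move: (thead x) Fi; exact/subsetPset/ndF/leq_maxl.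
  by move: Gj; apply/subsetPset/ndG/leq_maxr.
move=> k; have [mF Fk] := Foo k; have [mG Gk] := Goo k; split.
  by rewrite -[X in measurable X]setTI; apply: measurable_unconsRn => //;
    exact: measurableX.
by rewrite lebesgue_succX// lte_mul_pinfty// ge0_fin_numE.
Qed.

HB.instance Definition _ := Measure_isSigmaFinite.Build _ _ _ lebesgue_succ
  lebesgue_succ_sigma_finite.

End lebesgue_succ.

(* Lebesgue measure on R^n: the n-fold product of the Lebesgue measure on R
   (the unit point mass on the one-point space when n = 0). *)
Fixpoint lebesgueRn (R : realType) (n : nat) :
    {sigma_finite_measure set (Rn R n) -> \bar R} :=
  if n is n'.+1 then lebesgue_succ (lebesgueRn R n')
  else \d_([tuple] : Rn R 0).

Lemma lebesgueRn_box (R : realType) (n : nat)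
    (A : 'I_n -> set (measurableTypeR R)) :
  (forall i, measurable (A i)) ->
  lebesgueRn R n [set x | forall i, A i (tnth x i)] =
  (\prod_(i < n) lebesgue_measure (A i))%E.
Proof.
elim: n A => [|n IH] A mA.
  by rewrite big_ord0 /= diracE mem_set//= => -[].
rewrite big_ord_recl.
transitivity (lebesgue_succ (lebesgueRn R n) (unconsRn @^-1` (A ord0 `*`
    [set x : Rn R n | forall i : 'I_n, A (lift ord0 i) (tnth x i)]))).
  congr (lebesgue_succ _ _); apply/seteqP; split => x /=.
    move=> H; split => [|i]; first exact: (H ord0).
    by have := H (lift ord0 i); rewrite {1}(tuple_eta x) tnthS.
  move=> [A0 AS] i; case: (unliftP ord0 i) => [j ->|->]; last exact: A0.
  by rewrite {1}(tuple_eta x) tnthS; exact: AS.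
rewrite lebesgue_succX//.
  by congr (_ * _)%E; exact: (IH (fun i => A (lift ord0 i))).
rewrite (_ : mkset _ = \bigcap_(i in [set: 'I_n])
    (@tnth n (measurableTypeR R) ^~ i) @^-1` A (lift ord0 i)); last first.
  by apply/seteqP; split => x /= H i; [move=> _; exact: H|exact: (H i I)].
apply: fin_bigcap_measurable => //  i _.
by rewrite -[X in measurable X]setTI; apply: measurable_tnth.
Qed.

(* Where [f (x - y) g y] is not integrable in [y] (a null set of [x] when [f]
   and [g] are integrable) the value is arbitrary. *)
Definition convolution (R : realType) (n : nat) (f g : Rn R n -> R)
    (x : Rn R n) : R :=
  (\int[lebesgueRn R n]_y (f (vsub x y) * g y))%R.

(* Main.v *)
Require Import Defs.
From mathcomp Require Import all_boot all_order all_algebra.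
From mathcomp Require Import all_classical all_reals all_analysis.
From mathcomp Require Import measurable_realfun.
From mathcomp Require Import ring lra.
Import Order.TTheory GRing.Theory Num.Theory.
Import numFieldNormedType.Exports.
Local Open Scope classical_set_scope.
Local Open Scope ring_scope.

(** Write [d = n + 1] and let [f] be supported on the cone
[0 <= x_i <= x_0], which is stable under addition, and depend there on [t = x_0]
only: [f = c * exp(- lam t) * w t / t ^ n] with [w t = T / (t (t + T))] for
[t >= 1].  The section of the cone at height [r] has volume [r ^ n], so that
[f * f] at height [t] is at most
[c^2 exp(- lam t) * int_r (w r / r ^ n) (w (t - r) / (t - r) ^ n) min(r, t - r) ^ n].
Since [w] decays barely faster than [1 / t], the smaller of [r] and [t - r]
carries the integral ("single big jump") and this is at most
[c (2 int w + K) f] with [K] independent of [T].  Hence [f * f <= f] as soon as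
[c (2 int w + K) <= 1], while the mass of [f] tends to [c int w] as [lam] tends
to [0].  As [int w = ln (1 + T)] is arbitrarily large, every mass below [1 / 2]
is reached, and the factor [exp(- lam t)] gives the exponential moment. *)

(** * The radial profile and its pointwise convolution bound *)

Definition tail_weight (R : realType) (T t : R) : R :=
  if 1 <= t then T / (t * (t + T)) else 0.

Definition tail_profile (R : realType) (n : nat) (T lam t : R) : R :=
  expR (- (lam * t)) * tail_weight R T t / t ^+ n.

Arguments tail_weight {R}.
Arguments tail_profile {R}.

Section profile.
Variables (R : realType) (n : nat) (T lam : R).
Hypothesis T0 : 0 < T.

Lemma tail_weightE t : 1 <= t -> tail_weight T t = T / (t * (t + T)).
Proof. by rewrite /tail_weight => ->. Qed.

Lemma tail_weight_ge0 t : 0 <= tail_weight T t.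
Proof.
rewrite /tail_weight; case: ifPn => // t1; have t0 : 0 < t by lra.
by rewrite divr_ge0 ?mulr_ge0 ?addr_ge0 ?ltW.
Qed.

Lemma tail_profile_ge0 t : 0 <= tail_profile n T lam t.
Proof.
rewrite /tail_profile; have := tail_weight_ge0 t; rewrite /tail_weight.
case: ifPn => t1 w0; last by rewrite mulr0 mul0r.
by apply: divr_ge0; [exact: mulr_ge0 (expR_ge0 _) w0|rewrite exprn_ge0//; lra].
Qed.

Lemma tail_weight_lt1 t : t < 1 -> tail_weight T t = 0.
Proof. by rewrite /tail_weight leNgt => ->. Qed.

Lemma tail_profile_lt1 t : t < 1 -> tail_profile n T lam t = 0.
Proof. by move=> t1; rewrite /tail_profile tail_weight_lt1// mulr0 mul0r. Qed.


(** Convexity: on [[0, 1]] the power lies below its chord, which joins the values [1] and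
    [2 ^+ m]. *)
Lemma bernoulli_chord m (v : R) : 0 <= v <= 1 ->
  (1 + v) ^+ m <= 1 + (2 ^+ m - 1) * v.
Proof.
move=> /andP[v0 v1]; elim: m => [|m IH]; first by rewrite !expr0 subrr mul0r addr0.
have m1 : 1 <= 2 ^+ m :> R by rewrite exprn_ege1// ler1n.
rewrite !exprS; move: IH m1; set p := (1 + v) ^+ m; set q := 2 ^+ m => IH m1.
have v1' : 0 <= 1 + v by rewrite addr_ge0.
have : (1 + v) * p <= (1 + v) * (1 + (q - 1) * v) by rewrite ler_wpM2l.
move=> /le_trans; apply; rewrite -subr_ge0.
rewrite (_ : _ - _ = v * (1 - v) * (q - 1)); last by ring.
by rewrite !mulr_ge0 ?subr_ge0.
Qed.

(** Removing the smaller jump [r] from [t] costs a factor [1 + O(r / t)], uniformly in [T]: the only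
    factor involving [x + T] is [x / (x + T)], which increases in [x] and so only helps, and the
    rest is a pure power of [t / (t - r)]. *)
Lemma tail_weight_shift r t : 1 <= r -> r <= t - r ->
  tail_weight T (t - r) / (t - r) ^+ n <=
  (1 + 2 ^+ (n + 3) * (r / t)) * (tail_weight T t / t ^+ n).
Proof.
move=> r1 rt; have t0 : 0 < t by lra.
have u0 : 0 < t - r by lra.
have [u1 t1] : 1 <= t - r /\ 1 <= t by lra.
rewrite !tail_weightE//.
have E x : 0 < x -> T / (x * (x + T)) / x ^+ n = T * (x / (x + T)) * x^-1 ^+ n.+2.
  move=> x0; have xT0 : x + T != 0 by rewrite gt_eqF ?addr_gt0.
  have xn0 : x ^+ n != 0 by rewrite expf_neq0 ?gt_eqF.
  by rewrite !exprS exprVn; field; rewrite xn0 xT0 gt_eqF.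
rewrite !E//; move: u0 rt; set u := t - r.
have ur : u = t - r by []; clearbody u => u0 rt.
have q1 : t / u <= 1 + 2 * (r / t).
  rewrite ler_pdivrMr// -(ler_pM2r t0).
  have -> : (1 + 2 * (r / t)) * u * t = (t + 2 * r) * u.
    by field; rewrite gt_eqF.
  rewrite ur in rt *; rewrite -subr_ge0.
  rewrite [leRHS](_ : _ = r * (t - r - r)); last by ring.
  by rewrite mulr_ge0 ?subr_ge0//; lra.
have rt1 : 0 <= 2 * (r / t) <= 1.
  by rewrite mulrA divr_ge0/= ?ler_pdivrMr// ?mul1r; lra.
(* The chord bound at [v = 2 * (r / t)] has slope [2 ^+ n.+2 - 1] in [v]; dropping the [- 1] leaves
   [2 ^+ (n + 3)] in front of [r / t]. *)
have q2 : (t / u) ^+ n.+2 <= 1 + 2 ^+ (n + 3) * (r / t).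
  apply: (@le_trans _ _ ((1 + 2 * (r / t)) ^+ n.+2)).
    by rewrite lerXn2r// nnegrE ?divr_ge0 ?ltW//; lra.
  apply: (le_trans (bernoulli_chord _ _ rt1)).
  rewrite lerD2l addn3 [2 ^+ n.+3]exprSr -[leRHS]mulrA.
  by case/andP: rt1 => rt0 _; rewrite ler_wpM2r ?gerBl.
have -> : u^-1 ^+ n.+2 = (t / u) ^+ n.+2 * t^-1 ^+ n.+2.
  by rewrite -exprMn; congr (_ ^+ _); rewrite mulrAC divff ?mul1r// gt_eqF.
have q3 : u / (u + T) <= t / (t + T).
  have uT : 0 < u + T by exact: addr_gt0 u0 T0.
  have tT : 0 < t + T by exact: addr_gt0 t0 T0.
  rewrite ler_pdivrMr // mulrAC ler_pdivlMr // !mulrDr [u * t]mulrC lerD2l.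
  by rewrite ler_wpM2r ?ltW// ur; lra.
rewrite [leLHS](_ : _ = T * t^-1 ^+ n.+2 * ((u / (u + T)) * (t / u) ^+ n.+2)); last by ring.
rewrite [leRHS](_ : _ = T * t^-1 ^+ n.+2 * ((t / (t + T)) * (1 + 2 ^+ (n + 3) * (r / t)))); last by ring.
apply: ler_wpM2l; first by rewrite mulr_ge0 ?exprn_ge0 ?invr_ge0 ?ltW.
apply: ler_pM => //.
  by rewrite divr_ge0 ?addr_ge0 ?ltW.
by rewrite exprn_ge0 ?divr_ge0 ?ltW.
Qed.

(** The exponentials multiply exactly, the minimum cancels the power below the smaller jump, and
    [tail_weight_shift] compares the larger jump with [t]. The indicator keeps the error term
    integrable in [r], with integral independent of [t]. *)
Lemma tail_profile_mul r t :
  tail_profile n T lam (t - r) * tail_profile n T lam r *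
    Num.min (r ^+ n) ((t - r) ^+ n) <=
  tail_profile n T lam t * (tail_weight T r + tail_weight T (t - r) +
    2 ^+ (n + 3) / t * \1_(`[0, t]%classic : set R) r).
Proof.
have rhs0 : 0 <= tail_profile n T lam t * (tail_weight T r + tail_weight T (t - r) +
    2 ^+ (n + 3) / t * \1_(`[0, t]%classic : set R) r).
  have [t1|t1] := ltP t 1; first by rewrite tail_profile_lt1 ?mul0r.
  rewrite mulr_ge0 ?tail_profile_ge0// !addr_ge0 ?tail_weight_ge0//.
  by rewrite mulr_ge0 ?divr_ge0 ?exprn_ge0//; lra.
have [r1|r1] := ltP r 1; first by rewrite (tail_profile_lt1 _ r1) mulr0 mul0r.
have [s1|s1] := ltP (t - r) 1; first by rewrite (tail_profile_lt1 _ s1) !mul0r.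
have t0 : 0 < t by lra.
rewrite indicE mem_set ?mulr1/=; last by rewrite in_itv/=; lra.
(* With the indicator replaced by 1, both sides are invariant under [r -> t - r]. *)
wlog rs : r r1 s1 {rhs0} / r <= t - r.
  move=> H; have [|rs] := leP r (t - r); first exact: H.
  have tt : t - (t - r) = r by ring.
  have := H (t - r); rewrite tt => /(_ s1 r1 (ltW rs)).
  by rewrite minC [_ * tail_profile n T lam (t - r)]mulrC
    [tail_weight T (t - r) + _]addrC.
have key : tail_profile n T lam (t - r) * tail_profile n T lam r * r ^+ n <=
    tail_profile n T lam t * (tail_weight T r * (1 + 2 ^+ (n + 3) * (r / t))).
  rewrite /tail_profile.
  have -> : expR (- (lam * t)) = expR (- (lam * (t - r))) * expR (- (lam * r)).
    by rewrite -expRD; congr expR; ring.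
  set a := expR _; set b := expR _; set wr := tail_weight T r.
  have := tail_weight_shift _ _ r1 rs.
  set wu := tail_weight T (t - r); set wt := tail_weight T t => H.
  have rn : r ^+ n != 0 by rewrite expf_neq0 ?gt_eqF//; lra.
  rewrite [leLHS](_ : _ = (a * b * wr) * (wu / (t - r) ^+ n)); last first.
    by field; rewrite rn expf_neq0 ?gt_eqF//; lra.
  rewrite [leRHS](_ : _ = (a * b * wr) * ((1 + 2 ^+ (n + 3) * (r / t)) * (wt / t ^+ n))); last by ring.
  by rewrite ler_wpM2l// !mulr_ge0 ?expR_ge0 ?tail_weight_ge0.
apply: le_trans (le_trans key _).
  apply: ler_wpM2l; first by rewrite mulr_ge0 ?tail_profile_ge0.
  by rewrite ge_min lexx.
apply: ler_wpM2l; first exact: tail_profile_ge0.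
(* When [r] is the smaller jump its own weight suffices; the weight at [t - r] is discarded. *)
rewrite mulrDr mulr1 -addrA lerD2l.
rewrite -[leLHS]add0r lerD ?tail_weight_ge0//.
have r0 : 0 < r by lra.
have rT : 0 < r + T by exact: addr_gt0 r0 T0.
(* The error is harmless because [r * tail_weight T r = T / (r + T)] is at most 1, whatever [T]. *)
rewrite tail_weightE// [leLHS](_ : _ = 2 ^+ (n + 3) / t * (T / (r + T))).
  apply: ler_piMr; first by rewrite divr_ge0 ?exprn_ge0 ?ltW.
  rewrite ler_pdivrMr// mul1r.
  by rewrite lerDr ltW.
by field; rewrite !gt_eqF.
Qed.

End profile.

(** * Integrals of the profile over the real line *)

Section integrals.
Variable R : realType.
Local Notation mu := (@lebesgue_measure R).
Implicit Types (f : R -> \bar R).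

Lemma lebesgue_measure_reflect (t : R) (A : set (measurableTypeR R)) : measurable A ->
  pushforward mu ((fun r => t - r) : measurableTypeR R -> measurableTypeR R) A = mu A.
Proof.
move=> mA.
have mt : measurable_fun setT ((fun r => t - r) : measurableTypeR R -> measurableTypeR R).
  exact: measurable_funB.
pose m : {measure set (measurableTypeR R) -> \bar R} :=
  measure_function_pushforward__canonical__measure_function_Measure mu mt.
apply/esym/(@lebesgue_measure_unique _ m) => // _ [[a b]] _ <-.
rewrite /= /pushforward (_ : _ @^-1` _ = `[t - b, t - a[%classic).
  rewrite !lebesgue_measure_itv/= !lte_fin ltrD2l ltrN2 -!EFinB.
  by congr (if _ then EFin _ else _); ring.
by apply/seteqP; split => r /=; rewrite !in_itv/=; lra.
Qed.

Lemma ge0_integral_reflect (t : R) f :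
  measurable_fun [set: R] f -> (forall r, 0 <= f r)%E ->
  (\int[mu]_r f (t - r)%R = \int[mu]_r f r)%E.
Proof.
move=> mf f0.
have mt : measurable_fun setT ((fun r => t - r) : measurableTypeR R -> measurableTypeR R).
  exact: measurable_funB.
rewrite -[LHS](@ge0_integral_pushforward _ _ _ _ R _ mt mu setT f)//=.
by apply: eq_measure_integral => A mA _; exact: lebesgue_measure_reflect.
Qed.

(** Continuity is asked only on [[1, +oo[], so that the poles of the profile at [0] and [- T] do not
    matter. *)
Lemma measurable_if_ge1 (g : R -> R) :
  (forall t, 1 <= t -> {for t, continuous g}) ->
  measurable_fun [set: R] (fun t => if 1 <= t then g t else 0).
Proof.
move=> cg; apply: measurable_fun_if => //=; first exact: measurable_fun_ler.
rewrite setTI (_ : _ @^-1` _ = `[1, +oo[%classic); last first.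
  by apply/seteqP; split => t /=; rewrite in_itv/= andbT.
apply: subspace_continuous_measurable_fun => //.
apply/continuous_in_subspaceT => t; rewrite inE/= in_itv/= andbT; exact: cg.
Qed.

Lemma continuous_tail_weight (T t : R) : 0 < T -> 1 <= t ->
  {for t, continuous (fun u : R => T / (u * (u + T)))}.
Proof.
move=> T0 t1; have tT : 0 < t + T by apply: addr_gt0 => //; lra.
apply: cvgM; first exact: cvg_cst.
apply: cvgV; first by rewrite mulf_neq0// gt_eqF//; lra.
apply: cvgM => //; apply: cvgD => //; exact: cvg_cst.
Qed.

Lemma measurable_tail_weight (T : R) : 0 < T -> measurable_fun [set: R] (tail_weight T).
Proof.
by move=> T0; apply: measurable_if_ge1 => t t1; exact: continuous_tail_weight.
Qed.

Lemma measurable_tail_profile n (T lam : R) :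
  0 < T -> measurable_fun [set: R] (tail_profile n T lam).
Proof.
move=> T0; rewrite (_ : tail_profile n T lam = fun t => if 1 <= t then
  expR (- (lam * t)) * (T / (t * (t + T))) / t ^+ n else 0); last first.
  apply/funext => t; rewrite /tail_profile /tail_weight.
  by case: ifP => // _; rewrite mulr0 mul0r.
apply: measurable_if_ge1 => t t1; apply: cvgM.
  apply: cvgM; last exact: continuous_tail_weight.
  apply: continuous_cvg; first exact: continuous_expR.
  by apply: cvgN; apply: cvgM => //; exact: cvg_cst.
apply: cvgV; first by rewrite expf_neq0// gt_eqF//; lra.
exact: exprn_continuous.
Qed.

Lemma is_derive_ln_shift (T t : R) : 0 < T -> 0 < t ->
  is_derive (t : R) (1 : R) (fun u => ln u - ln (u + T)) (T / (t * (t + T))).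
Proof.
move=> T0 t0; have tT : 0 < t + T by exact: addr_gt0.
have d1 := is_derive1_ln t0.
have d2 : is_derive (t : R) (1 : R) (fun u : R => u + T) (1 + 0).
  exact: is_deriveD.
have d3 : is_derive (t : R) (1 : R) (fun u : R => ln (u + T)) ((t + T)^-1 * (1 + 0)).
  by apply: (@is_derive1_comp _ (@ln R)); exact: is_derive1_ln.
have -> : T / (t * (t + T)) = t^-1 - (t + T)^-1 * (1 + 0).
  by field; rewrite !gt_eqF.
exact: is_deriveB d1 d3.
Qed.

(** The primitive [ln t - ln (t + T) = - ln (1 + T / t)] tends to 0 at infinity and equals
    [- ln (1 + T)] at 1. Each weight is thus integrable, but the integral is unbounded in [T]. *)
Lemma integral_tail_weight (T : R) : 0 < T ->
  (\int[mu]_t (tail_weight T t)%:E = (ln (1 + T))%:E)%E.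
Proof.
move=> T0.
transitivity (\int[mu]_(t in `[1%R, +oo[) (T / (t * (t + T)))%:E)%E.
  rewrite [RHS]integral_mkcond; apply: eq_integral => t _.
  by rewrite patchE /tail_weight mem_setE in_itv/= andbT; case: ifP.
rewrite (@ge0_continuous_FTC2y _ _ (fun t => ln t - ln (t + T)) _ 0).
- by rewrite ln1 sub0r sub0e EFinN oppeK.
- by move=> t t1; rewrite divr_ge0 ?mulr_ge0//; lra.
- apply/continuous_in_subspaceT => t; rewrite inE/= in_itv/= andbT => t1.
  exact: continuous_tail_weight.
- have : - ln (1 + T * t^-1) @[t --> +oo] --> (- ln (1 + T * 0) : R).
    apply: cvgN; apply: continuous_cvg.
      by rewrite mulr0 addr0; exact: continuous_ln.
    apply: cvgD; first exact: cvg_cst.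
    apply: cvgM; first exact: cvg_cst.
    by apply/gtr0_cvgV0 => //; exact: nbhs_pinfty_gt.
  rewrite mulr0 addr0 ln1 oppr0; apply: cvg_trans.
  apply: near_eq_cvg; near=> t.
  have t0 : 0 < t by near: t; exact: nbhs_pinfty_gt.
  rewrite -[_ - _]opprB -ln_div ?posrE ?addr_gt0//.
  by rewrite mulrDl divff// gt_eqF.
- by move=> t t1; apply: ex_derive; apply: is_derive_ln_shift => //; lra.
- apply: cvg_at_right_filter; apply: cvgB; first exact: continuous_ln.
  apply: continuous_cvg; first by apply: continuous_ln; lra.
  apply: cvgD => //; exact: cvg_cst.
- move=> t; rewrite in_itv/= andbT => t1; rewrite derive1E.
  by apply: derive_val; apply: is_derive_ln_shift => //; lra.
Unshelve. all: end_near. Qed.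

(** Integration of [tail_profile_mul]: by reflection both weights contribute [ln (1 + T)], and the
    error contributes [2 ^+ (n + 3) / t] times the length [t]. *)
Lemma integral_tail_profile_mul_le n (T lam t : R) : 0 < T ->
  (\int[mu]_r (tail_profile n T lam (t - r) * tail_profile n T lam r *
      Num.min (r ^+ n) ((t - r) ^+ n))%:E <=
   (tail_profile n T lam t * (2 * ln (1 + T) + 2 ^+ (n + 3)))%:E)%E.
Proof.
move=> T0; have w0 u := tail_weight_ge0 _ _ T0 u.
have p0 u := tail_profile_ge0 _ n _ lam T0 u.
have mw := measurable_tail_weight _ T0.
have mp := measurable_tail_profile n _ lam T0.
have mt : measurable_fun [set: R] (fun r : R => t - r) by exact: measurable_funB.
have mwt : measurable_fun [set: R] (fun r : R => tail_weight T (t - r)).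
  exact: measurableT_comp.
(* For [t < 1] both sides vanish, as [r] and [t - r] cannot both be at least 1. *)
have [t1|t1] := ltP t 1.
  rewrite (tail_profile_lt1 _ _ _ _ _ t1) mul0r integral0_eq// => r _.
  have [r1|r1] := ltP r 1; first by rewrite (tail_profile_lt1 _ _ _ _ _ r1) mulr0 mul0r.
  by rewrite tail_profile_lt1 ?mul0r//; lra.
set K := 2 ^+ (n + 3) : R.
have K0 : 0 <= K by rewrite exprn_ge0.
have t0 : 0 < t by lra.
pose g r : R := tail_weight T r + tail_weight T (t - r) +
    K / t * \1_(`[0, t]%classic : set R) r.
have mi : measurable_fun [set: R] (fun r => K / t * \1_(`[0, t]%classic : set R) r).
  by apply: measurable_funM => //; exact: measurable_indic.
have i0 r : 0 <= K / t * \1_(`[0, t]%classic : set R) r.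
  by rewrite mulr_ge0// divr_ge0// ltW.
have Ig : (\int[mu]_r (g r)%:E = (2 * ln (1 + T) + K)%:E)%E.
  under eq_integral do rewrite /g !EFinD.
  rewrite ge0_integralD//=; first last.
  - exact/measurable_EFinP.
  - by move=> r _; rewrite lee_fin.
  - by apply: emeasurable_funD; exact/measurable_EFinP.
  - by move=> r _; rewrite -EFinD lee_fin addr_ge0.
  rewrite ge0_integralD//=; first last.
  - exact/measurable_EFinP.
  - by move=> r _; rewrite lee_fin.
  - exact/measurable_EFinP.
  - by move=> r _; rewrite lee_fin.
  rewrite (ge0_integral_reflect t (fun r => (tail_weight T r)%:E)); first last.
  - by move=> r; rewrite lee_fin.
  - exact/measurable_EFinP.
  rewrite integral_tail_weight//.
  under eq_integral do rewrite EFinM.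
  rewrite ge0_integralZl_EFin//=; first last.
  - by rewrite divr_ge0// ltW.
  - by apply/measurable_EFinP; exact: measurable_indic.
  rewrite integral_indic//= setIT lebesgue_measure_itv/= lte_fin t0.
  rewrite -EFinB subr0 -EFinM -!EFinD; congr EFin.
  by field; rewrite gt_eqF.
rewrite EFinM -Ig -ge0_integralZl_EFin//=; first last.
- by apply/measurable_EFinP; apply: measurable_funD => //; exact: measurable_funD.
- by move=> r _; rewrite lee_fin !addr_ge0.
apply: ge0_le_integral => //=.
(* For odd [n] the minimum can be negative, but only where one of the two profiles is zero. *)
- move=> r _; have [r1|r1] := ltP r 1.
    by rewrite (tail_profile_lt1 _ _ _ _ _ r1) mulr0 mul0r.
  have [s1|s1] := ltP (t - r) 1.
    by rewrite (tail_profile_lt1 _ _ _ _ _ s1) !mul0r.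
  rewrite lee_fin; apply: mulr_ge0; first exact: mulr_ge0.
  by rewrite le_min !exprn_ge0//; lra.
- apply/measurable_EFinP; apply: measurable_funM.
    by apply: measurable_funM => //; exact: measurableT_comp.
  by apply: measurable_minr; exact: measurable_funX.
- apply/measurable_EFinP; apply: measurable_funM => //.
  by apply: measurable_funD => //; exact: measurable_funD.
- by move=> r _; rewrite lee_fin; exact: tail_profile_mul.
Qed.

(** Dominated convergence along [lam = 1 / (m + 1)], with the untilted weight as dominating
    function: the tilted integrals tend to [ln (1 + T)], so some of them exceed [b]. *)
Lemma exists_tilt (T b : R) : 0 < T -> b < ln (1 + T) ->
  exists2 lam, 0 < lam &
    (b%:E < \int[mu]_t (expR (- (lam * t)) * tail_weight T t)%:E)%E.
Proof.
move=> T0 bT; have w0 u := tail_weight_ge0 _ _ T0 u.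
have mw := measurable_tail_weight _ T0.
have mp lam : measurable_fun [set: R] (fun t => expR (- (lam * t)) * tail_weight T t).
  apply: (eq_measurable_fun (tail_profile 0 T lam)).
    by move=> t _; rewrite /tail_profile expr0 divr1.
  exact: measurable_tail_profile.
have iw : mu.-integrable setT (fun t => (tail_weight T t)%:E).
  apply/integrableP; split; first exact/measurable_EFinP.
  under eq_integral do rewrite gee0_abs ?lee_fin//.
  by rewrite integral_tail_weight// ltry.
pose f_ m t := (expR (- (m.+1%:R^-1 * t)) * tail_weight T t)%:E.
have mf_ m : measurable_fun [set: R] (f_ m) by exact/measurable_EFinP.
have mwE : measurable_fun [set: R] (EFin \o tail_weight T) by exact/measurable_EFinP.
have f_cvg : {ae mu, forall t, setT t -> f_ ^~ t @ \oo --> (tail_weight T t)%:E}.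
  apply: aeW => /= t _; apply: cvg_EFin; first exact: nearW.
  rewrite -[X in _ --> X]mul1r; apply: cvgMl.
  rewrite -[X in _ --> X]expR0; apply: continuous_cvg; first exact: continuous_expR.
  rewrite -oppr0 -(mul0r t); apply: cvgN; apply: cvgMl.
  exact: cvg_harmonic.
have f_le : {ae mu, forall t m, setT t -> (`|f_ m t| <= (tail_weight T t)%:E)%E}.
  apply: aeW => t m _ /=; have [t1|t1] := ltP t 1.
    by rewrite /f_ tail_weight_lt1// mulr0 normr0.
  rewrite lee_fin ger0_norm; last by rewrite mulr_ge0 ?expR_ge0.
  rewrite ler_piMl// -expR0 ler_expR oppr_le0 mulr_ge0 ?invr_ge0//; lra.
have [_ _] := @dominated_convergence _ (measurableTypeR R) R mu setT measurableT
  f_ (EFin \o tail_weight T) (EFin \o tail_weight T) mf_ mwE f_cvg iw f_le.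
rewrite /comp integral_tail_weight// => If.
have /If [N _ /(_ N (leqnn N)) /= bN] : nbhs (ln (1 + T))%:E [set x | b%:E < x]%E.
  by apply: open_nbhs_nbhs; split; [exact: open_ereal_gt_ereal|rewrite /= lte_fin].
by exists (N.+1%:R^-1); rewrite ?invr_gt0.
Qed.

End integrals.

(** * Densities on the cone, their mass and their self-convolution *)

Definition cone {R : realType} {n : nat} : set (Rn R n.+1) :=
  [set x | forall i, 0 <= tnth x i <= tnth x ord0].

Definition cone_density {R : realType} {n : nat} (g : R -> R) (x : Rn R n.+1) : R :=
  g (tnth x ord0) * \1_cone x.

Section cone.
Variables (R : realType) (n : nat).
Local Notation mu := (@lebesgue_measure R).
Local Notation nu := (lebesgueRn R n).
Implicit Types (g : R -> R) (t r : R).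

Lemma measurable_box (m : nat) (A : 'I_m -> set (measurableTypeR R)) :
  (forall i, measurable (A i)) ->
  measurable [set x : Rn R m | forall i, A i (tnth x i)].
Proof.
move=> mA; rewrite (_ : mkset _ = \bigcap_(i in [set: 'I_m])
    (@tnth m (measurableTypeR R) ^~ i) @^-1` A i); last first.
  by apply/seteqP; split => x /= H i; [move=> _; exact: H|exact: (H i I)].
apply: fin_bigcap_measurable => // i _.
by rewrite -[X in measurable X]setTI; apply: measurable_tnth.
Qed.

Lemma measurable_tnthR (m : nat) (i : 'I_m) :
  measurable_fun [set: Rn R m] (fun x => tnth x i : R).
Proof. exact: measurable_tnth. Qed.

Lemma measurable_cone : measurable (@cone R n).
Proof.
rewrite (_ : cone = \bigcap_(i in [set: 'I_n.+1])
    [set x | 0 <= tnth x i <= tnth x ord0]); last first.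
  by apply/seteqP; split => x /= H i; [move=> _; exact: H|exact: (H i I)].
apply: fin_bigcap_measurable => // i _.
have := @measurable_and _ (Rn R n.+1) setT (fun x => 0 <= tnth x i)
  (fun x => tnth x i <= tnth x ord0).
move=> /(_ _ _ measurableT [set true]); rewrite setTI; apply => //.
  by apply: measurable_fun_ler => //; exact: measurable_tnthR.
by apply: measurable_fun_ler; exact: measurable_tnthR.
Qed.

Lemma measurable_cone_density g : measurable_fun [set: R] g ->
  measurable_fun [set: Rn R n.+1] (cone_density g).
Proof.
move=> mg; apply: measurable_funM.
  by apply: (measurableT_comp mg); exact: measurable_tnthR.
exact: measurable_indic measurable_cone.
Qed.

Lemma cone_density_ge0 g x : (forall t, 0 <= g t) -> 0 <= @cone_density R n g x.
Proof. by move=> g0; rewrite mulr_ge0. Qed.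

Lemma ge0_integral_consRn (h : Rn R n.+1 -> \bar R) :
  measurable_fun setT h -> (forall x, 0 <= h x)%E ->
  (\int[lebesgueRn R n.+1]_x h x = \int[mu]_t \int[nu]_y h (consRn (t, y)))%E.
Proof.
move=> mh h0.
transitivity (\int[(mu \x nu)]_p (h \o consRn) p)%E.
  exact: (ge0_integral_pushforward measurable_consRn).
rewrite fubini_tonelli1//=.
by apply: measurableT_comp => //; exact: measurable_consRn.
Qed.


(** The corner is arbitrary because bounding the convolution requires a translated cube as well as
    the section of the cone. *)
Lemma lebesgueRn_cube (a : 'I_n -> R) (l : R) : 0 <= l ->
  nu [set y | forall i, `[a i, a i + l]%classic (tnth y i)] = (l ^+ n)%:E.
Proof.
move=> l0; rewrite (@lebesgueRn_box R n (fun i => `[a i, a i + l]%classic))//.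
rewrite (eq_bigr (fun=> l%:E)) => [|i _].
  by rewrite prodEFin prodr_const card_ord.
rewrite lebesgue_measure_itv/= lte_fin ltrDl -EFinD.
case: ltP => [_|l1]; first by congr EFin; ring.
by congr EFin; lra.
Qed.

Lemma cone_consRn t (y : Rn R n) : 0 <= t ->
  cone (consRn (t, y)) <-> forall i, `[0, 0 + t]%classic (tnth y i).
Proof.
move=> t0; split => [H i|H i].
  by have := H (lift ord0 i); rewrite tnthS/= tnth0 in_itv/= add0r.
case: (unliftP ord0 i) => [j ->|->]; last by rewrite tnth0 t0 lexx.
by have := H j; rewrite tnthS tnth0/= in_itv/= add0r.
Qed.

(** By Tonelli, the section at height [t >= 0] being a cube of side [t]. For [t < 0] the section is
    empty although [t ^+ n] is not 0 in general, hence the vanishing condition on [g]. *)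
Lemma ge0_integral_cone_density g : measurable_fun [set: R] g ->
  (forall t, 0 <= g t) -> (forall t, t < 0 -> g t = 0) ->
  (\int[lebesgueRn R n.+1]_x (cone_density g x)%:E =
   \int[mu]_t (g t * t ^+ n)%:E)%E.
Proof.
move=> mg g0 gN; rewrite ge0_integral_consRn; first last.
- by move=> x; rewrite lee_fin; exact: cone_density_ge0.
- by apply/measurable_EFinP; exact: measurable_cone_density.
apply: eq_integral => t _; have [t0|t0] := ltP t 0.
  rewrite gN// mul0r; apply: integral0_eq => y _.
  by rewrite /cone_density tnth0 gN// mul0r.
pose Q := [set y : Rn R n | forall i, `[0, 0 + t]%classic (tnth y i)].
have mQ : measurable Q.
  by apply: (measurable_box n (fun=> `[0, 0 + t]%classic)).
transitivity (\int[nu]_y ((g t)%:E * (\1_Q y)%:E))%E.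
  apply: eq_integral => y _; rewrite /cone_density tnth0 EFinM; congr (_ * _%:E)%E.
  by rewrite !indicE; congr ((nat_of_bool _)%:R); apply/idP/idP => /set_mem/cone_consRn H;
    apply/mem_set; apply/H.
rewrite ge0_integralZl_EFin//=; last first.
  by apply/measurable_EFinP; exact: measurable_indic.
rewrite integral_indic// setIT EFinM; congr (_ * _)%E.
exact: (lebesgueRn_cube (fun=> 0)).
Qed.

Lemma measurable_vsub (m : nat) (x : Rn R m) : measurable_fun setT (vsub x).
Proof.
apply/measurable_fun_tnthP => i.
rewrite (_ : _ \o _ = fun y => (tnth x i - tnth y i : R)).
  by apply: measurable_funB => //; exact: measurable_tnthR.
by apply/funext => y /=; rewrite tnth_mktuple.
Qed.

(** At height [r], the points [y] with [y] and [x - y] both in the cone lie in a cube of side [r]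
    and in another of side [t - r], where [t] is the height of [x]. The section therefore has volume
    at most the minimum in the hypothesis. *)
Lemma convolution_cone_density_le g x : measurable_fun [set: R] g ->
  (forall t, 0 <= g t) -> (forall t, t < 0 -> g t = 0) ->
  (forall t, (\int[mu]_r (g (t - r) * g r * Num.min (r ^+ n) ((t - r) ^+ n))%:E <=
     (g t)%:E)%E) ->
  convolution (cone_density g) (cone_density g) x <= @cone_density R n g x.
Proof.
move=> mg g0 gN gconv; rewrite /convolution /Rintegral.
set I := (\int[_]_y _)%E.
(* [convolution] is the [fine] part of [I]; the bound on [I] also makes it finite, so nothing is
   lost. *)
suff I_le : (I <= (cone_density g x)%:E)%E.
  have I0 : (0 <= I)%E.
    by apply: integral_ge0 => y _; rewrite lee_fin mulr_ge0// cone_density_ge0.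
  rewrite -lee_fin fineK// ge0_fin_numE//; exact: le_lt_trans I_le (ltry _).
have mI : measurable_fun setT
    (fun y => (cone_density g (vsub x y) * cone_density g y)%:E).
  apply/measurable_EFinP; apply: measurable_funM; last exact: measurable_cone_density.
  apply: (measurableT_comp (measurable_cone_density _ mg)); exact: measurable_vsub.
rewrite {}/I ge0_integral_consRn//; last first.
  by move=> y; rewrite lee_fin mulr_ge0// cone_density_ge0.
set t := tnth x ord0.
(* Outside the cone the integrand vanishes, since the cone is stable under addition. *)
have [xC|xC] := pselect (cone x); last first.
  rewrite integral0_eq ?lee_fin ?cone_density_ge0// => r _.
  apply: integral0_eq => y _; rewrite /cone_density !indicE.
  have [/set_mem c1|] := boolP (vsub x (consRn (r, y)) \in cone); last by rewrite !(mulr0, mul0r).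
  have [/set_mem c2|] := boolP (consRn (r, y) \in cone); last by rewrite !mulr0.
  exfalso; apply: xC => i; have := c1 i; have := c2 i.
  rewrite !tnth_mktuple; lra.
rewrite [leRHS](_ : _ = (g t)%:E); last first.
  by rewrite /cone_density indicE mem_set// mulr1.
apply: le_trans (gconv t); apply: ge0_le_integral => //.
- move=> r _; apply: integral_ge0 => y _; rewrite lee_fin.
  by rewrite mulr_ge0// cone_density_ge0.
- by apply: (measurable_fun_fubini_tonelli_F _ (measurableT_comp mI measurable_consRn)) => p;
    rewrite lee_fin mulr_ge0// cone_density_ge0.
- apply/measurable_EFinP; apply: measurable_funM.
    apply: measurable_funM => //; apply: measurableT_comp => //.
    exact: measurable_funB.
  apply: measurable_minr; apply: measurable_funX => //.
  exact: measurable_funB.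
move=> r _.
have E y : (cone_density g (vsub x (consRn (r, y))) * cone_density g (consRn (r, y)))
  = g (t - r) * g r * (\1_cone (vsub x (consRn (r, y))) * \1_cone (consRn (r, y))).
  by rewrite /cone_density tnth_mktuple tnth0 /t; ring.
under eq_integral do rewrite E.
have [r0|r0] := ltP r 0.
  rewrite (gN r)// mulr0 mul0r.
  by under eq_integral do rewrite mul0r; rewrite integral0.
have [s0|s0] := ltP (t - r) 0.
  rewrite (gN (t - r))// !mul0r.
  by under eq_integral do rewrite !mul0r; rewrite integral0.
have gg : 0 <= g (t - r) * g r by rewrite mulr_ge0.
have cube_le (a : 'I_n -> R) l : 0 <= l ->
    (forall y, cone (consRn (r, y)) -> cone (vsub x (consRn (r, y))) ->
      forall i, `[a i, a i + l]%classic (tnth y i)) ->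
    (\int[nu]_y (g (t - r) * g r *
      (\1_cone (vsub x (consRn (r, y))) * \1_cone (consRn (r, y))))%:E <=
     (g (t - r) * g r * l ^+ n)%:E)%E.
  move=> l0 H; pose Q := [set y : Rn R n | forall i, `[a i, a i + l]%classic (tnth y i)].
  have mQ : measurable Q by apply: (measurable_box n (fun i => `[a i, a i + l]%classic)).
  rewrite EFinM -(lebesgueRn_cube a)// -/Q -(setIT Q) -integral_indic//.
  rewrite -ge0_integralZl_EFin//; last first.
    by apply/measurable_EFinP; exact: measurable_indic.
  apply: ge0_le_integral => //.
  - by move=> y _; rewrite lee_fin !mulr_ge0.
  - under eq_fun do rewrite -E.
    apply: measurableT_comp mI _; apply: measurableT_comp measurable_consRn _.
    exact: pair1_measurable.
  - by apply: emeasurable_funM => //; apply/measurable_EFinP; exact: measurable_indic.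
  - move=> y _; rewrite -EFinM lee_fin ler_wpM2l// !indicE.
    have [/set_mem c1|] := boolP (vsub x (consRn (r, y)) \in cone); last by rewrite mul0r.
    have [/set_mem c2|] := boolP (consRn (r, y) \in cone); last by rewrite mulr0.
    by rewrite (mem_set (H _ c2 c1 : Q y)) mulr1.
have [le|le] := leP (r ^+ n) ((t - r) ^+ n).
  apply: (cube_le (fun=> 0)) => // y c2 _.
  exact/cone_consRn.
(* That [x - y] lies in the cone means that each remaining [y_i] is between [x_i - (t - r)] and
   [x_i]. *)
apply: (cube_le (fun i => tnth x (lift ord0 i) - (t - r))) => // y c2 c1 i.
have := c1 (lift ord0 i); rewrite !tnth_mktuple tnthS !tnth0/= in_itv/= -/t; lra.
Qed.

End cone.

(** * Norm against height on the cone, and the choice of parameters *)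

Lemma enorm_cone_le (R : realType) (n : nat) (x : Rn R n.+1) :
  cone x -> enorm x <= n.+1%:R * tnth x ord0.
Proof.
move=> xC; have x0 : 0 <= tnth x ord0 by have /andP[] := xC ord0.
have nx0 : 0 <= n.+1%:R * tnth x ord0 by rewrite mulr_ge0.
rewrite -[leRHS]ger0_norm// -sqrtr_sqr ler_sqrt ?sqr_ge0//.
(* The sharp constant would be the square root of [n + 1]; the cruder [n + 1] is enough for some
   positive [eps]. *)
apply: (@le_trans _ _ (\sum_(i < n.+1) tnth x ord0 ^+ 2)).
  by apply: ler_sum => i _; have /andP[? ?] := xC i; rewrite lerXn2r ?nnegrE.
rewrite sumr_const card_ord exprMn -[leLHS]mulr_natl ler_wpM2r ?sqr_ge0//.
by rewrite expr2 ler_peMl// ler1n.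
Qed.

Lemma measurable_enorm (R : realType) (m : nat) :
  measurable_fun [set: Rn R m] (@enorm R m).
Proof.
apply: measurableT_comp; first exact: continuous_measurable_fun (@sqrt_continuous R).
apply: measurable_sum => i; apply: measurable_funX; exact: measurable_tnthR.
Qed.

Theorem mainTheorem4 (R : realType) (d : nat) (hd : (1 <= d)%N)
    (a : R) (ha : 0 <= a < 1 / 2) :
  exists (f : Rn R d -> R) (eps : R),
    [/\ 0 < eps,
        (lebesgueRn R d).-integrable setT (EFin \o f),
        {ae lebesgueRn R d, forall x, f x >= convolution f f x},
        (\int[lebesgueRn R d]_x (f x)%:E = a%:E)%E &
        (\int[lebesgueRn R d]_x (expR (eps * enorm x) * f x)%:E < +oo)%E].
Proof.
case: d hd => [//|n] _; case/andP: ha => a0 a1.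
pose K : R := 2 ^+ (n + 3).
have K0 : 0 < K by rewrite exprn_gt0.
have a2 : 0 < 1 - 2 * a by lra.
(* Solves [a * (2 * L + K) < L], which is possible because [a < 1 / 2]; the [+ 1] makes the
   inequality strict and [L] positive even for [a = 0]. *)
pose L := a * K / (1 - 2 * a) + 1.
have aK : 0 <= a * K by exact: mulr_ge0 a0 (ltW K0).
have L0 : 0 < L by exact: ltr_wpDl (divr_ge0 aK (ltW a2)) ltr01.
pose T := expR L - 1.
have T0 : 0 < T by rewrite subr_gt0 expR_gt1.
have LT : ln (1 + T) = L by rewrite /T addrC subrK expRK.
have bL : a * (2 * L + K) < L.
  rewrite -subr_gt0 (_ : _ - _ = 1 - 2 * a); first by [].
  by rewrite /L; field; rewrite gt_eqF.
(* The tilt is small enough for the tilted mass to inherit the strict inequality satisfied by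
   [L]. *)
have [lam lam0] : exists2 lam, 0 < lam & ((a * (2 * L + K))%:E <
    \int[lebesgue_measure]_t (expR (- (lam * t)) * tail_weight T t)%:E)%E.
  by apply: exists_tilt => //; rewrite LT.
set I := (\int[_]_t _)%E => bI.
have w0 u := tail_weight_ge0 _ _ T0 u.
have p0 l u := tail_profile_ge0 _ n _ l T0 u.
have mp l := measurable_tail_profile _ n _ l T0.
have pn l t : tail_profile n T l t * t ^+ n = expR (- (l * t)) * tail_weight T t.
  have [t1|t1] := ltP t 1; first by rewrite tail_profile_lt1// tail_weight_lt1// mul0r mulr0.
  by rewrite /tail_profile mulfVK// expf_neq0// gt_eqF//; lra.
have mpn l : measurable_fun [set: R] (fun t => expR (- (l * t)) * tail_weight T t).
  under eq_fun do rewrite -pn.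
  by apply: measurable_funM => //; exact: measurable_funX.
have I_le : (I <= L%:E)%E.
  rewrite -LT -integral_tail_weight//; apply: ge0_le_integral => //.
  - by move=> t _; rewrite lee_fin mulr_ge0 ?expR_ge0.
  - by apply/measurable_EFinP; exact: mpn.
  - by apply/measurable_EFinP; exact: measurable_tail_weight.
  - move=> t _; rewrite lee_fin; have [t1|t1] := ltP t 1.
      by rewrite tail_weight_lt1// mulr0.
    by rewrite ler_piMl// -expR0 ler_expR oppr_le0 mulr_ge0 ?ltW//; lra.
have If : I \is a fin_num.
  rewrite ge0_fin_numE; first exact: le_lt_trans I_le (ltry _).
  by apply: integral_ge0 => t _; rewrite lee_fin mulr_ge0 ?expR_ge0.
pose v := fine I; have Iv : I = v%:E by rewrite /v fineK.
have bv : a * (2 * L + K) < v by rewrite -lte_fin -Iv.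
have LK0 : 0 < 2 * L + K by rewrite addr_gt0 ?mulr_gt0.
have v0 : 0 < v by exact: le_lt_trans (mulr_ge0 a0 (ltW LK0)) bv.
(* This normalisation gives mass exactly [a], and the lower bound on [v] becomes
   [c * (2 * L + K) <= 1]. *)
pose c := a / v.
have c0 : 0 <= c by exact: divr_ge0 a0 (ltW v0).
have cLK : c * (2 * L + K) <= 1.
  by rewrite /c mulrAC ler_pdivrMr// mul1r ltW.
(* The tilt stays a parameter: [l = lam] gives the density sought, [l = 0] a majorant for its
   exponential moment. *)
pose g l t := c * tail_profile n T l t.
have g0 l t : 0 <= g l t by rewrite mulr_ge0.
have mg l : measurable_fun [set: R] (g l) by exact: measurable_funM.
have gN l t : t < 0 -> g l t = 0.
  by move=> t0; rewrite /g tail_profile_lt1 ?mulr0//; lra.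
have intg l : (\int[lebesgueRn R n.+1]_x (cone_density (g l) x)%:E =
    c%:E * \int[lebesgue_measure]_t (expR (- (l * t)) * tail_weight T t)%:E)%E.
  rewrite ge0_integral_cone_density//; last exact: gN.
  rewrite -ge0_integralZl_EFin//; last first.
  - by apply/measurable_EFinP; exact: mpn.
  - by move=> t _; rewrite lee_fin mulr_ge0 ?expR_ge0.
  by apply: eq_integral => t _; rewrite -EFinM -pn mulrA.
have mf l : measurable_fun [set: Rn R n.+1] (EFin \o cone_density (g l)).
  by apply/measurable_EFinP; exact: measurable_cone_density.
have f0 l x : 0 <= @cone_density R n (g l) x by exact: cone_density_ge0.
have intf : (\int[lebesgueRn R n.+1]_x (cone_density (g lam) x)%:E = a%:E)%E.
  by rewrite intg -/I Iv -EFinM /c mulfVK// gt_eqF.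
exists (cone_density (g lam)), (lam / n.+1%:R); split => //.
- by rewrite divr_gt0.
- apply/integrableP; split => //=.
  under eq_integral do rewrite ger0_norm//.
  by rewrite intf ltry.
- apply: aeW => x; apply: convolution_cone_density_le => // [|t]; first exact: gN.
  under eq_integral.
    move=> r _; rewrite [X in X%:E](_ : _ = c ^+ 2 * (tail_profile n T lam (t - r) *
      tail_profile n T lam r * Num.min (r ^+ n) ((t - r) ^+ n))); last by rewrite /g; ring.
    rewrite EFinM; over.
  rewrite ge0_integralZl_EFin ?sqr_ge0//; first last.
  - have mt : measurable_fun [set: R] (fun r : R => t - r) by exact: measurable_funB.
    have mpt : measurable_fun [set: R] (fun r : R => tail_profile n T lam (t - r)).
      exact: (measurableT_comp (mp lam) mt).
    apply/measurable_EFinP; apply: measurable_funM.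
      exact: (measurable_funM mpt (mp lam)).
    by apply: measurable_minr; exact: measurable_funX.
  - move=> r _; have [r1|r1] := ltP r 1.
      by rewrite (tail_profile_lt1 _ _ _ _ _ r1) mulr0 mul0r.
    have [s1|s1] := ltP (t - r) 1.
      by rewrite (tail_profile_lt1 _ _ _ _ _ s1) !mul0r.
    rewrite lee_fin; apply: mulr_ge0; first exact: mulr_ge0.
    by rewrite le_min !exprn_ge0//; lra.
  apply: (le_trans (lee_wpmul2l _ (integral_tail_profile_mul_le _ _ _ _ _ T0))).
    by rewrite lee_fin sqr_ge0.
  (* One factor [c] of [c ^+ 2] belongs to the density; the other is absorbed by [cLK]. *)
  rewrite -EFinM lee_fin /g -/K LT.
  rewrite [leLHS](_ : _ = c * tail_profile n T lam t * (c * (2 * L + K))); last by ring.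
  by rewrite ler_piMr// mulr_ge0.
(* With [eps = lam / (n + 1)], [enorm_cone_le] gives [eps * enorm x <= lam * x_0] on the cone, so
   the exponential weight is cancelled by the tilt. The untilted density that remains has mass
   [c * ln (1 + T)]. *)
- apply: (@le_lt_trans _ _ (\int[lebesgueRn R n.+1]_x (cone_density (g 0) x)%:E)%E).
    apply: ge0_le_integral => //.
    + by move=> x _; rewrite lee_fin mulr_ge0 ?expR_ge0.
    + apply/measurable_EFinP; apply: measurable_funM.
        apply: measurableT_comp => //; apply: measurable_funM => //.
        exact: measurable_enorm.
      exact: measurable_cone_density.
    + exact: mf.
    + move=> x _; rewrite lee_fin /cone_density mulrA indicE.
      have [/set_mem xC|] := boolP (x \in cone); last by rewrite !mulr0.
      rewrite !mulr1 /g mulrCA; apply: ler_wpM2l => //.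
      set t := tnth x ord0; rewrite /tail_profile mul0r oppr0 expR0 mul1r.
      have [t1|t1] := ltP t 1; first by rewrite tail_weight_lt1// mulr0 !mul0r mulr0.
      rewrite !mulrA -expRD -mulrA; apply: ler_piMl.
        by rewrite divr_ge0// exprn_ge0//; lra.
      rewrite -[leRHS]expR0 ler_expR subr_le0 mulrAC ler_pdivrMr// -mulrA.
      apply: ler_wpM2l; first exact: ltW.
     by rewrite [leRHS]mulrC; exact: enorm_cone_le.
  rewrite intg; under eq_integral do rewrite mul0r oppr0 expR0 mul1r.
  by rewrite integral_tail_weight// -EFinM ltry.
Qed.
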